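(* Let $G_p$ and $G_c$ be IF-OFP systems with passivity indices $(\nu_p,\rho_p)$ and $(\nu_c,\rho_c)$ respectively, interconnected in the two-sided event-triggered feedback loop described in the context, where the triggering instants $t_{p_k}$ and $t_{c_k}$ are determined by the conditions $\|e_p(t)\|_2^2>\delta_p\|y_p(t)\|_2^2$ with $\delta_p\in(0,1]$ and $\|e_c(t)\|_2^2>\delta_c\|y_c(t)\|_2^2$ with $\delta_c\in(0,1]$, respectively, and let $w_2=0$. Let $$\beta(\nu_p)=\begin{cases}\rho_c-\nu_p-\delta_c(1+\nu_p)&\text{if }\nu_p>0,\\ \rho_c-\delta_c&\text{if }\nu_p=0,\\ \rho_c+2\nu_p-\delta_c(1-3\nu_p)&\text{if }\nu_p<0,\end{cases}\qquad \beta(\nu_c)=\begin{cases}\rho_p-\nu_c-\delta_p(1+\nu_c)&\text{if }\nu_c>0,\\ \rho_p-\delta_p&\text{if }\nu_c=0,\\ \rho_p+2\nu_c-\delta_p(1-3\nu_c)&\text{if }\nu_c<0.\end{cases}$$ If $\beta(\nu_p)\ge\tfrac14$, $\nu_p=0$ and $\beta(\nu_c)\ge\tfrac14$, then the networked control system is passive from $w_1$ to $y_p$, meaning $$\dot V(t)\le w_1^T(t)y_p(t)$$ for a storage function $V$ of the interconnection.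
   Context: Systems: a system $G$ has the form $\dot x=f(x,u)$, $y=h(x,u)$ with state $x\in X\subset\mathbb{R}^n$ and $u(t),y(t)\in\mathbb{R}^m$. A storage function is a nonnegative function $V$ of the state; it is taken differentiable, and $\dot V(t)$ is the time derivative along solutions. $G$ is IF-OFP (input feed-forward output feedback passive) with input passivity index $\nu\in\mathbb{R}$ and output passivity index $\rho\in\mathbb{R}$ (of either sign) if there is a storage function $V$ with $\dot V\le u^Ty-\rho y^Ty-\nu u^Tu$ for all $t$ along all solutions. Two-sided event-triggered loop: $G_p$ (plant, state $x_p$, input $u_p$, output $y_p$) has indices $(\nu_p,\rho_p)$, and $G_c$ (controller, state $x_c$, input $u_c$, output $y_c$) has indices $(\nu_c,\rho_c)$; all inputs and outputs are $\mathbb{R}^m$-valued. External signals $w_1,w_2$ are $\mathbb{R}^m$-valued. At event instants $t_{p_k}$ the plant output is sampled, sent to the controller and held until the next plant event; at event instants $t_{c_k}$ the controller output is sampled, sent to the plant and held until the next controller event. With $e_p(t)=y_p(t)-y_p(t_{p_k})$ for $t\in[t_{p_k},t_{p_{k+1}})$ and $e_c(t)=y_c(t)-y_c(t_{c_k})$ for $t\in[t_{c_k},t_{c_{k+1}})$, the inputs are $u_c(t)=w_2(t)+y_p(t_{p_k})=w_2(t)+y_p(t)-e_p(t)$ and $u_p(t)=w_1(t)-y_c(t_{c_k})=w_1(t)+e_c(t)-y_c(t)$. A new plant (resp. controller) event is triggered as soon as $\|e_p(t)\|_2^2>\delta_p\|y_p(t)\|_2^2$ (resp. $\|e_c(t)\|_2^2>\delta_c\|y_c(t)\|_2^2$),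 Euclidean norms at time $t$, so that $e_p^Te_p\le\delta_p y_p^Ty_p$ and $e_c^Te_c\le\delta_c y_c^Ty_c$ hold at all times. A storage function of the interconnection is a nonnegative function $V$ of $(x_p,x_c)$; inequalities on $\dot V$ are required along all solutions for all $t$ in the inter-event intervals. *)

(* Defs.v *)
From HB Require Import structures.
From mathcomp Require Import all_boot all_order all_algebra.
From mathcomp Require Import all_classical all_reals all_analysis.

Set Implicit Arguments.
Unset Strict Implicit.
Unset Printing Implicit Defensive.

Import Order.TTheory GRing.Theory Num.Theory.
Import numFieldNormedType.Exports.

Local Open Scope classical_set_scope.
Local Open Scope ring_scope.

Definition dot (R : realType) (m : nat) (u v : 'cV[R]_m) : R := (u^T *m v) 0 0.

(* The library norm on matrices is the sup norm, hence this Euclidean one. *)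
Definition enorm (R : realType) (m : nat) (v : 'cV[R]_m) : R :=
  Num.sqrt (dot v v).

(* Derivative of [g] at [t] relative to [I]: for I = [a, b[ this is the usual
   derivative at interior points and the right derivative at t = a. *)
Definition time_derivative (R : realType) (U : normedModType R) (I : set R)
    (g : R -> U) (t : R) (l : U) : Prop :=
  (fun s => (s - t)^-1 *: (g s - g t)) @ within I t^' --> l.

(* x' = f(x, u), y = h(x, u), with x in [state]; [f] and [h] are only relevant
   on [state]. *)
Record system (R : realType) (n m : nat) := System {
  state : set 'cV[R]_n ;
  dyn : 'cV[R]_n -> 'cV[R]_m -> 'cV[R]_n ;
  out : 'cV[R]_n -> 'cV[R]_m -> 'cV[R]_m }.

(* The time interval [0, T[, where T = +oo is allowed: solutions need not be
   global. *)
Definition horizon (R : realType) (T : \bar R) : set R :=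
  [set t | 0 <= t /\ (t%:E < T)%E].

Definition continuity_piece (R : realType) (m : nat) (T : \bar R)
    (u : R -> 'cV[R]_m) (a b : R) : Prop :=
  [/\ a < b, `[a, b[ `<=` horizon T & {within `[a, b[, continuous u}].

(* Inputs may jump (in the loop they do, at every event), but are continuous
   from the right and continuous for some time after every instant. *)
Definition admissible (R : realType) (m : nat) (T : \bar R)
    (u : R -> 'cV[R]_m) : Prop :=
  forall t, horizon T t -> exists b, continuity_piece T u t b.

(* The state is continuous; the differential equation holds throughout every
   interval [a, b[ on which the input is continuous. *)
Definition solution (R : realType) (n m : nat) (G : system R n m) (T : \bar R)
    (x : R -> 'cV[R]_n) (u y : R -> 'cV[R]_m) : Prop :=
  [/\ admissible T u,
      {within horizon T, continuous x},
      forall t, horizon T t -> state G (x t) /\ y t = out G (x t) (u t)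
    & forall a b, continuity_piece T u a b -> forall t, t \in `[a, b[ ->
        time_derivative `[a, b[ x t (dyn G (x t) (u t))].

Definition storage (R : realType) (S : normedModType R) (X : set S)
    (V : S -> R) : Prop :=
  forall x, X x -> 0 <= V x /\ differentiable (V : S -> R^o) x.

(* The time derivative of V along z exists at t and is at most s. *)
Definition Vdot_le (R : realType) (S : normedModType R) (I : set R)
    (V : S -> R) (z : R -> S) (t s : R) : Prop :=
  exists2 v : R, time_derivative I (fun r => V (z r) : R^o) t v & v <= s.

Definition IF_OFP (R : realType) (n m : nat) (G : system R n m)
    (nu rho : R) : Prop :=
  exists2 V : 'cV[R]_n -> R, storage (state G) V &
    forall (T : \bar R) x u y, solution G T x u y ->
    forall a b, continuity_piece T u a b -> forall t, t \in `[a, b[ ->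
      Vdot_le `[a, b[ V x t
        (dot (u t) (y t) - rho * dot (y t) (y t) - nu * dot (u t) (u t)).

(* Times s after the sampling instant [tk] at which the error
   e(s) = y(s) - y(tk) satisfies |e(s)|^2 > delta |y(s)|^2. *)
Definition trigger_times (R : realType) (m : nat) (T : \bar R) (delta : R)
    (y : R -> 'cV[R]_m) (tk : \bar R) : set R :=
  [set s | (tk < s%:E < T)%E /\
           enorm (y s - y (fine tk)) ^+ 2 > delta * enorm (y s) ^+ 2].

(* The first sample is taken at time 0. [tau k = +oo] encodes that there are
   fewer than k + 1 events (the infimum of the empty set is +oo). The last
   clause says that the inter-event intervals cover [0, T[; for a Zeno
   execution, T is at most the accumulation time. *)
Definition event_instants (R : realType) (m : nat) (T : \bar R) (delta : R)
    (y : R -> 'cV[R]_m) (tau : nat -> \bar R) : Prop :=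
  [/\ tau 0%N = 0%E,
      forall k, tau k.+1 =
        ereal_inf [set s%:E | s in trigger_times T delta y (tau k)]
    & forall t, horizon T t -> exists k, (tau k <= t%:E < tau k.+1)%E].

Record event_triggered_loop (R : realType) (np nc m : nat)
    (Gp : system R np m) (Gc : system R nc m) (deltap deltac : R)
    (T : \bar R) (w1 w2 : R -> 'cV[R]_m) (tp tc : nat -> \bar R)
    (xp : R -> 'cV[R]_np) (up yp : R -> 'cV[R]_m)
    (xc : R -> 'cV[R]_nc) (uc yc : R -> 'cV[R]_m) : Prop := {
  loop_plant : solution Gp T xp up yp ;
  loop_controller : solution Gc T xc uc yc ;
  loop_plant_events : event_instants T deltap yp tp ;
  loop_controller_events : event_instants T deltac yc tc ;
  loop_uc : forall k t, horizon T t -> (tp k <= t%:E < tp k.+1)%E ->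
    uc t = w2 t + yp (fine (tp k)) ;
  loop_up : forall k t, horizon T t -> (tc k <= t%:E < tc k.+1)%E ->
    up t = w1 t - yc (fine (tc k)) }.

(* [a, b[ ranges over the intervals that contain no event, except possibly at
   a, and on which w1 is continuous. *)
Definition passive_w1_yp (R : realType) (np nc m : nat)
    (Gp : system R np m) (Gc : system R nc m) (deltap deltac : R) : Prop :=
  exists2 V : 'cV[R]_np * 'cV[R]_nc -> R,
    storage (state Gp `*` state Gc) V &
    forall (T : \bar R) w1 tp tc xp up yp xc uc yc,
      event_triggered_loop Gp Gc deltap deltac T w1 (fun=> 0) tp tc
        xp up yp xc uc yc ->
    forall k j a b,
      (tp k <= a%:E)%E -> (b%:E <= tp k.+1)%E ->
      (tc j <= a%:E)%E -> (b%:E <= tc j.+1)%E ->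
      continuity_piece T w1 a b ->
    forall t, t \in `[a, b[ ->
      Vdot_le `[a, b[ V (fun s => (xp s, xc s)) t (dot (w1 t) (yp t)).

(* beta(nu_p) is [beta rhoc nup deltac]; beta(nu_c) is [beta rhop nuc deltap]. *)
Definition beta (R : realType) (rho nu delta : R) : R :=
  if 0 < nu then rho - nu - delta * (1 + nu)
  else if nu == 0 then rho - delta
  else rho + 2 * nu - delta * (1 - 3 * nu).

(* Main.v *)
Require Import Defs.
From HB Require Import structures.
From mathcomp Require Import all_boot all_order all_algebra.
From mathcomp Require Import all_classical all_reals all_analysis.
From mathcomp Require Import lra.

(** Take V(x_p, x_c) = V_p(x_p) + V_c(x_c), the sum of the storage functions of
    the two subsystems.  Between events both held samples are constant, so both
    loop inputs are continuous there and the two dissipation inequalities may be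
    added.  With u_p = w_1 + e_c - y_c, u_c = y_p - e_p and nu_p = 0, the terms
    in y_p^T y_c cancel (negative feedback) and the sum of the supply rates is

      w_1^T y_p + e_c^T y_p - e_p^T y_c - rho_p |y_p|^2 - rho_c |y_c|^2
        - nu_c |y_p - e_p|^2.

    Young's inequality u^T v <= |u|^2 + |v|^2 / 4 splits the two cross terms
    ([dot_young]), and the triggering rule bounds |e_p|^2 by delta_p |y_p|^2 and
    |e_c|^2 by delta_c |y_c|^2 ([held_error_le]).  The coefficient of |y_c|^2 is
    then at most 1/4 + delta_c - rho_c = 1/4 - beta(nu_p).  For |y_p|^2 the term
    in nu_c is dropped if nu_c >= 0, and bounded through
    |y_p - e_p|^2 <= 2 (1 + delta_p) |y_p|^2 if nu_c < 0; in both cases the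
    coefficient is at most 1/4 - beta(nu_c) ([supply_rates_le]).  The quarters
    in the hypotheses on beta are thus exactly those of Young's inequality. *)

Set Implicit Arguments.
Unset Strict Implicit.
Unset Printing Implicit Defensive.

Import Order.TTheory GRing.Theory Num.Theory.
Import numFieldNormedType.Exports.

Local Open Scope classical_set_scope.
Local Open Scope ring_scope.

Lemma dotE (R : realType) (m : nat) (u v : 'cV[R]_m) :
  dot u v = \sum_i u i 0 * v i 0.
Proof. by rewrite /dot mxE; apply: eq_bigr => i _; rewrite mxE. Qed.

Lemma dotC (R : realType) (m : nat) (u v : 'cV[R]_m) : dot u v = dot v u.
Proof. by rewrite !dotE; apply: eq_bigr => i _; rewrite mulrC. Qed.

Lemma dotDl (R : realType) (m : nat) (u v w : 'cV[R]_m) :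
  dot (u + v) w = dot u w + dot v w.
Proof.
by rewrite !dotE -big_split; apply: eq_bigr => i _; rewrite !mxE mulrDl.
Qed.

Lemma dotNl (R : realType) (m : nat) (u v : 'cV[R]_m) :
  dot (- u) v = - dot u v.
Proof. by rewrite !dotE -sumrN; apply: eq_bigr => i _; rewrite mxE mulNr. Qed.

Lemma dotBl (R : realType) (m : nat) (u v w : 'cV[R]_m) :
  dot (u - v) w = dot u w - dot v w.
Proof. by rewrite dotDl dotNl. Qed.

Lemma dotDr (R : realType) (m : nat) (u v w : 'cV[R]_m) :
  dot u (v + w) = dot u v + dot u w.
Proof. by rewrite dotC dotDl !(dotC u). Qed.

Lemma dotBr (R : realType) (m : nat) (u v w : 'cV[R]_m) :
  dot u (v - w) = dot u v - dot u w.
Proof. by rewrite dotC dotBl !(dotC u). Qed.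

Lemma dot_ge0 (R : realType) (m : nat) (u : 'cV[R]_m) : 0 <= dot u u.
Proof. by rewrite dotE sumr_ge0 // => i _; rewrite -expr2 sqr_ge0. Qed.

Lemma enorm_sqr (R : realType) (m : nat) (u : 'cV[R]_m) :
  enorm u ^+ 2 = dot u u.
Proof. by rewrite /enorm sqr_sqrtr ?dot_ge0. Qed.

Lemma dot_young (R : realType) (m : nat) (u v : 'cV[R]_m) :
  dot u v <= dot u u + dot v v / 4.
Proof.
(* |2 u - v|^2 >= 0 *)
have := dot_ge0 (u + u - v).
by rewrite !(dotBl, dotBr, dotDl, dotDr) (dotC v u); lra.
Qed.

Lemma dot_sub_le (R : realType) (m : nat) (u v : 'cV[R]_m) :
  dot (u - v) (u - v) <= 2 * dot u u + 2 * dot v v.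
Proof.
have := dot_ge0 (u + v).
by rewrite !(dotBl, dotBr, dotDl, dotDr) (dotC v u); lra.
Qed.

(** The next event is the infimum of the violation times, so no time before it
    is a violation time; at the sampling instant itself the error is 0. *)
Lemma held_error_le (R : realType) (m : nat) (T : \bar R) (delta : R)
    (y : R -> 'cV[R]_m) (tau : nat -> \bar R) (k : nat) (t : R) :
  0 <= delta -> event_instants T delta y tau -> horizon T t ->
  (tau k <= t%:E < tau k.+1)%E ->
  dot (y t - y (fine (tau k))) (y t - y (fine (tau k)))
    <= delta * dot (y t) (y t).
Proof.
move=> delta0 [_ tauS _] [_ tT] /andP[]; rewrite le_eqVlt => /orP[/eqP->|lt_kt].
  by move=> _ /=; rewrite subrr dotE big1 ?mulr_ge0 ?dot_ge0 // => i _;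
     rewrite !mxE mul0r.
rewrite tauS => lt_tS; rewrite leNgt; apply/negP => viol.
suff : (t%:E < t%:E)%E by rewrite ltxx.
apply: (lt_le_trans lt_tS); apply: ereal_inf_lbound; exists t => //.
by split; [rewrite lt_kt tT | rewrite !enorm_sqr].
Qed.

Lemma continuity_piece_eq (R : realType) (m : nat) (T : \bar R)
    (u v : R -> 'cV[R]_m) (a b : R) :
  {in `[a, b[, u =1 v} -> continuity_piece T u a b -> continuity_piece T v a b.
Proof.
move=> uv [ab abT cu]; split=> //; apply: subspace_eq_continuous cu => s.
by rewrite inE; exact: uv.
Qed.

Lemma continuity_piece_cst (R : realType) (m : nat) (T : \bar R)
    (c : 'cV[R]_m) (a b : R) :
  a < b -> `[a, b[ `<=` horizon T -> continuity_piece T (fun=> c) a b.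
Proof. by move=> ab abT; split=> // s; exact: cvg_cst. Qed.

Lemma continuity_pieceB_cst (R : realType) (m : nat) (T : \bar R)
    (u : R -> 'cV[R]_m) (c : 'cV[R]_m) (a b : R) :
  continuity_piece T u a b -> continuity_piece T (fun t => u t - c) a b.
Proof.
by move=> [ab abT cu]; split=> // s; apply: cvgB; [exact: cu | exact: cvg_cst].
Qed.

Lemma storage_sum (R : realType) (S1 S2 : normedModType R)
    (X1 : set S1) (X2 : set S2) (V1 : S1 -> R) (V2 : S2 -> R) :
  storage X1 V1 -> storage X2 V2 ->
  storage (X1 `*` X2) (fun p : S1 * S2 => V1 p.1 + V2 p.2).
Proof.
move=> st1 st2 [x1 x2] [/= /st1[V1_0 dV1] /st2[V2_0 dV2]].
split; first exact: addr_ge0.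
have d1 : differentiable ((V1 : S1 -> R^o) \o (@fst S1 S2)) (x1, x2).
  apply: differentiable_comp => //; apply: linear_differentiable => x.
  exact: cvg_fst.
have d2 : differentiable ((V2 : S2 -> R^o) \o (@snd S1 S2)) (x1, x2).
  apply: differentiable_comp => //; apply: linear_differentiable => x.
  exact: cvg_snd.
exact: differentiableD d1 d2.
Qed.

Lemma Vdot_le_sum (R : realType) (S1 S2 : normedModType R) (I : set R)
    (V1 : S1 -> R) (V2 : S2 -> R) (z1 : R -> S1) (z2 : R -> S2) (t s1 s2 : R) :
  Vdot_le I V1 z1 t s1 -> Vdot_le I V2 z2 t s2 ->
  Vdot_le I (fun p : S1 * S2 => V1 p.1 + V2 p.2) (fun s => (z1 s, z2 s)) t
    (s1 + s2).
Proof.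
move=> [v1 d1 v1s1] [v2 d2 v2s2]; exists (v1 + v2); last exact: lerD.
rewrite /time_derivative /=.
rewrite [X in X @ _ --> _](_ : _ =
    (fun s => (s - t)^-1 *: (V1 (z1 s) - V1 (z1 t) : R^o)) \+
    (fun s => (s - t)^-1 *: (V2 (z2 s) - V2 (z2 t) : R^o))).
  exact: (@cvgD R R^o).
by apply/funext => s /=; rewrite -scalerDr opprD addrACA.
Qed.

Lemma Vdot_le_trans (R : realType) (S : normedModType R) (I : set R)
    (V : S -> R) (z : R -> S) (t s s' : R) :
  s <= s' -> Vdot_le I V z t s -> Vdot_le I V z t s'.
Proof. by move=> ss' [v dv vs]; exists v => //; exact: le_trans ss'. Qed.

(** One subsystem's outgoing channel: [e] is the sampling error of its output
    [y], [rho] its own output index, and [nu] the input index of the subsystem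
    that receives the held sample [y - e].  The term [dot y y / 4] is what
    Young's inequality charges to [y] for the error on the opposite channel.
    For [nu < 0] the penalty [- nu * dot (y - e) (y - e)] is at most
    [- nu * (2 + 2 * delta) * dot y y], within the margin
    [- nu * (2 + 3 * delta) * dot y y] that [beta] reserves for it. *)
Lemma beta_absorbs (R : realType) (m : nat) (rho nu delta : R)
    (y e : 'cV[R]_m) :
  0 <= delta -> 1 / 4 <= beta rho nu delta ->
  dot e e <= delta * dot y y ->
  dot e e + dot y y / 4 - rho * dot y y - nu * dot (y - e) (y - e) <= 0.
Proof.
move=> delta0 + ey; have Y0 := dot_ge0 y; have D0 := dot_ge0 (y - e).
have D_le := dot_sub_le y e.
have dY0 : 0 <= delta * dot y y by exact: mulr_ge0.
rewrite /beta; case: ltgtP => [nu0|nu0|<-] /(ler_wpM2r Y0) hb.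
- have := mulr_ge0 (ltW nu0) D0; have := mulr_ge0 (ltW nu0) dY0.
  have := mulr_ge0 (ltW nu0) Y0; lra.
- have nu'0 : 0 <= - nu by rewrite oppr_ge0 ltW.
  have D_le' : dot (y - e) (y - e) <= 2 * dot y y + 2 * (delta * dot y y).
    by lra.
  have := ler_wpM2l nu'0 D_le'; have := mulr_ge0 nu'0 dY0; lra.
- lra.
Qed.

Lemma supply_rates_le (R : realType) (m : nat)
    (rhop nuc rhoc deltap deltac : R) (w yp yc ep ec : 'cV[R]_m) :
  0 <= deltap -> 0 <= deltac ->
  1 / 4 <= beta rhoc 0 deltac -> 1 / 4 <= beta rhop nuc deltap ->
  dot ep ep <= deltap * dot yp yp -> dot ec ec <= deltac * dot yc yc ->
  (dot (w + ec - yc) yp - rhop * dot yp yp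
     - 0 * dot (w + ec - yc) (w + ec - yc))
  + (dot (yp - ep) yc - rhoc * dot yc yc - nuc * dot (yp - ep) (yp - ep))
  <= dot w yp.
Proof.
move=> dp0 dc0 hp hc ep_le ec_le.
have := beta_absorbs dp0 hc ep_le; have := beta_absorbs dc0 hp ec_le.
have := dot_young ec yp.
have := dot_young (- ep) yc; rewrite !dotNl (dotC ep (- ep)) dotNl opprK.
rewrite (dotBl (w + ec) yc yp) (dotDl w) (dotBl yp ep yc) (dotC yc yp).
lra.
Qed.

Theorem theorem12 (R : realType) (np nc m : nat)
    (Gp : system R np m) (Gc : system R nc m)
    (nup rhop nuc rhoc deltap deltac : R)
    (hGp : IF_OFP Gp nup rhop) (hGc : IF_OFP Gc nuc rhoc)
    (hdeltap : 0 < deltap <= 1) (hdeltac : 0 < deltac <= 1)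
    (hbetap : 1 / 4 <= beta rhoc nup deltac)
    (hnup : nup = 0)
    (hbetac : 1 / 4 <= beta rhop nuc deltap) :
  passive_w1_yp Gp Gc deltap deltac.
Proof.
subst nup; case: hGp => Vp stp dVp; case: hGc => Vc stc dVc.
exists (fun p => Vp p.1 + Vc p.2); first exact: storage_sum.
move=> T w1 tp tc xp up yp xc uc yc [solp solc evp evc huc hup].
move=> k j a b tpa tpb tca tcb pw t tab.
have [ab abT _] := pw.
have between (tau : nat -> \bar R) i s : (tau i <= a%:E)%E ->
    (b%:E <= tau i.+1)%E -> s \in `[a, b[ -> (tau i <= s%:E < tau i.+1)%E.
  move=> taua taub; rewrite in_itv /= => /andP[as_ sb]; apply/andP; split.
    by apply: le_trans taua _; rewrite lee_fin.
  by apply: lt_le_trans taub; rewrite lte_fin.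
have hold_p s : s \in `[a, b[ -> up s = w1 s - yc (fine (tc j)).
  by move=> sab; apply: hup; [exact: abT | exact: between].
have hold_c s : s \in `[a, b[ -> uc s = yp (fine (tp k)).
  move=> sab; rewrite (huc k) ?add0r //; [exact: abT | exact: between].
have piece_up : continuity_piece T up a b.
  apply: continuity_piece_eq (continuity_pieceB_cst (yc (fine (tc j))) pw).
  by move=> s /hold_p ->.
have piece_uc : continuity_piece T uc a b.
  apply: continuity_piece_eq (continuity_piece_cst (yp (fine (tp k))) ab abT).
  by move=> s /hold_c ->.
have := Vdot_le_sum (dVp _ _ _ _ solp _ _ piece_up _ tab)
                    (dVc _ _ _ _ solc _ _ piece_uc _ tab).
apply: Vdot_le_trans.
have [[dp0 _] [dc0 _]] := (andP hdeltap, andP hdeltac).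
set ep := yp t - yp (fine (tp k)); set ec := yc t - yc (fine (tc j)).
have -> : up t = w1 t + ec - yc t by rewrite hold_p // addrA addrAC addrK.
have -> : uc t = yp t - ep by rewrite hold_c // subKr.
apply: (@supply_rates_le _ _ _ _ _ deltap deltac) => //; try exact: ltW.
- by apply: held_error_le evp (abT _ tab) (between _ _ _ tpa tpb tab); apply: ltW.
- by apply: held_error_le evc (abT _ tab) (between _ _ _ tca tcb tab); apply: ltW.
Qed.
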